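(* For every integer $k\ge 3$, $src^*(C_{(k-1)^2}(\{1,k\}))=rc^*(C_{(k-1)^2}(\{1,k\}))=2k-4$.
   Context: For $n\ge 2$ and $S\subseteq\{1,\dots,n-1\}$, the circulant digraph $C_n(S)$ has vertex set $\{v_0,\dots,v_{n-1}\}$ and arcs $v_iv_j$ for all $i,j$ with $j-i\equiv s \pmod n$ for some $s\in S$. For a strongly connected digraph $D$ and an arc-colouring $\Gamma:A(D)\to\{1,\dots,k\}$, a directed path is rainbow if its arcs have pairwise distinct colours. $\Gamma$ is rainbow connected if for every ordered pair of distinct vertices $x,y$ there is a rainbow directed $xy$-path; $rc^*(D)$ is the minimum number of colours of such a colouring. $\Gamma$ is strongly rainbow connected if for every ordered pair of distinct vertices $x,y$ there is a rainbow directed $xy$-path of length $d_D(x,y)$; $src^*(D)$ is the minimum such number. *)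

(* Defs.v *)
From mathcomp Require Import all_boot.
Set Implicit Arguments. Unset Strict Implicit. Unset Printing Implicit Defensive.

Definition circulant (n : nat) (S : seq nat) : rel 'I_n :=
  fun i j => has (fun s => (i + s) %% n == j %% n) S.

Arguments circulant : clear implicits.

(* A directed path x = v_0, v_1, ..., v_l = y, given as x and the list
   [v_1; ...; v_l]; vertices pairwise distinct, consecutive ones joined by arcs.
   Its length is size p. *)
Definition dpath (n : nat) (D : rel 'I_n) (x y : 'I_n) (p : seq 'I_n) : bool :=
  [&& path D x p, uniq (x :: p) & last x p == y].

Definition arcs_of (n : nat) (x : 'I_n) (p : seq 'I_n) : seq ('I_n * 'I_n) :=
  zip (x :: p) p.

Definition rainbow (n c : nat) (col : 'I_n -> 'I_n -> 'I_c)
    (x : 'I_n) (p : seq 'I_n) : bool :=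
  uniq (map (fun a => col a.1 a.2) (arcs_of x p)).

Definition rainbow_connected (n c : nat) (D : rel 'I_n)
    (col : 'I_n -> 'I_n -> 'I_c) : Prop :=
  forall x y : 'I_n, x != y ->
    exists p, dpath D x y p && rainbow col x p.

(* Strongly rainbow connected: a rainbow xy-path of length d(x,y), i.e. of
   length at most that of every xy-path. *)
Definition strongly_rainbow_connected (n c : nat) (D : rel 'I_n)
    (col : 'I_n -> 'I_n -> 'I_c) : Prop :=
  forall x y : 'I_n, x != y ->
    exists p, [/\ dpath D x y p, rainbow col x p &
                  forall q, dpath D x y q -> size p <= size q].

Definition rc_star_eq (n : nat) (D : rel 'I_n) (r : nat) : Prop :=
  (exists col : 'I_n -> 'I_n -> 'I_r, rainbow_connected D col) /\
  (forall c (col : 'I_n -> 'I_n -> 'I_c), rainbow_connected D col -> r <= c).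

Definition src_star_eq (n : nat) (D : rel 'I_n) (r : nat) : Prop :=
  (exists col : 'I_n -> 'I_n -> 'I_r, strongly_rainbow_connected D col) /\
  (forall c (col : 'I_n -> 'I_n -> 'I_c), strongly_rainbow_connected D col -> r <= c).

(* Main.v *)
(** Put [m = k - 1], so that the digraph has [m ^ 2] vertices and arcs of
    stride [1] (short) and [m + 1] (long).  Modulo [m] both strides are [1], which
    shows that every vertex is reached from another one by a shortest walk with
    [a] short and [b] long arcs, where [a <= m] and [b <= m - 2], or [a = 0] and
    [b = m - 1].  The case [a = m], [b = m - 2] gives the diameter [2 m - 2], hence
    the lower bound.

    For the upper bound, write a vertex as [p (m + 1)]: a long arc becomes
    [p -> p + 1] and a short one [p -> p - (m - 1)].  Arrange the [p] in rows of
    length [m - 1], so that long arcs move along rows and short arcs move up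
    columns; the last [p] is alone in row [m + 1].  Short arcs receive
    [p mod m], which grows by one along every arc, and the long arc leaving column
    [c] an extra colour [m + c], except that the last column also receives
    [p mod m].  A path is rainbow when its extra colours are distinct and its
    remaining arcs sit at positions that are distinct modulo [m].  Going around the
    top of the array shifts the columns by one, and so allows a path with [m] short
    arcs to skip the last column.  Paths that start in the rows [m - 1] and [m]
    cannot do so; for them the short arcs leaving row [m - 1] receive extra colours
    too, and the last long arc of row [m] receives the colour [0]. *)

Require Import Defs.
From mathcomp Require Import all_boot.
From mathcomp Require Import zify.

Set Implicit Arguments.
Unset Strict Implicit.
Unset Printing Implicit Defensive.

(** * Shortest words in the strides [1] and [m + 1] *)

(** Both strides are [1] modulo [m], so a shorter rival saves a multiple of [m] arcs, and
    [a + b < 2 * m] leaves only [m]; when [a = 0] even that is too many. Cancelling then gives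
    [b' = b + 1] modulo [m], against [b' <= b < m - 1]. *)
Lemma shortest_word m a b a' b' :
  a <= m -> (b + 2 <= m) || (a == 0) && (b < m) ->
  a + m.+1 * b = a' + m.+1 * b' %[mod m ^ 2] -> a + b <= a' + b'.
Proof.
move=> ha hb e; rewrite leqNgt; apply/negP => lt.
have m0 : 0 < m by lia.
have em : a + b = a' + b' %[mod m].
  have := congr1 (modn^~ m) e.
  rewrite /= !modn_dvdm ?dvdn_exp // !mulSn (addnA a) (addnA a').
  by rewrite ![_ + m * _]addnC ![m * _]mulnC !modnMDl.
have /dvdnP[t et] : m %| (a + b) - (a' + b').
  by rewrite -eqn_mod_dvd ?(ltnW lt) //; apply/eqP.
have t1 : t = 1.
  case: t et => [|[|t]] et //; first lia.
  rewrite !mulSn in et; case/orP: hb => [|/andP[/eqP]]; lia.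
move: et; rewrite t1 mul1n => et.
case/orP: hb => hb; last by case/andP: hb => /eqP; lia.
move: e; rewrite !mulSn (addnA a) (addnA a').
have -> : a + b = a' + b' + m by lia.
rewrite -addnA -mulnS => /eqP; rewrite eqn_modDl -mulnn -!muln_modr.
rewrite eqn_pmul2l // modn_small; last lia.
by rewrite modn_small; lia.
Qed.

Lemma distance_word m d : 0 < d < m ^ 2 -> exists a b,
  [/\ a <= m, (b + 2 <= m) || (a == 0) && (b < m) & a + m.+1 * b = d].
Proof.
case/andP=> d0; rewrite -mulnn => dm.
have m0 : 0 < m by case: (m) dm.
have hq : d %/ m < m by rewrite ltn_divLR.
have hr := ltn_pmod d m0; have e := divn_eq d m.
move: (d %/ m) (d %% m) hq hr e => q r hq hr e.
(* As [d = q * m + r], taking [q] long arcs leaves [r - q] short ones; if [r < q], one long arc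
   fewer leaves [m + 1] more. *)
case: (leqP q r) => h.
  exists (r - q), q; split; [lia | | by rewrite mulSn e (mulnC m); lia].
  by apply/orP; case: (ltnP q.+1 m) => h'; [left | right]; lia.
case: q h e hq => // q h e hq; exists (m + r - q), q.
by split; [lia | lia | rewrite e !mulSn (mulnC m); lia].
Qed.

(** Cutting out cycles yields a path on some of the vertices of [p]; minimality makes it as long as
    [p], which thus has no repetition. *)
Lemma shortest_path_uniq (T : eqType) (e : rel T) x p :
  path e x p -> (forall q, path e x q -> last x q = last x p -> size p <= size q) ->
  uniq (x :: p).
Proof.
move=> pth; case: (shortenP pth) => q pq uq sq /(_ q pq erefl) le.
apply: (leq_size_uniq uq) => // y.
by rewrite !inE => /orP[->|/sq ->]; rewrite ?orbT.
Qed.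

(** * Walks as words, the lower bound, and the reduction to a colouring of positions *)

(* The arcs of a walk are encoded by a word, with [true] for a long arc. *)
Definition stride m (b : bool) := if b then m.+1 else 1.

Definition shift m (w : seq bool) :=
  count negb w + m.+1 * count id w.

Definition adv m n b (x : 'I_n) : 'I_n :=
  Ordinal (ltn_pmod (x + stride m b) (leq_ltn_trans (leq0n x) (ltn_ord x))).

Fixpoint walk m n (w : seq bool) (x : 'I_n) : seq 'I_n :=
  if w is b :: w' then adv m b x :: walk m w' (adv m b x) else [::].

(* The multiplier is the inverse of [m.+1] modulo [m ^ 2]: in this coordinate a
   long arc is a step by 1 and a short arc a step by [- (m - 1)]. *)
Definition pos m n (x : 'I_n) := x * (m ^ 2 - m.-1) %% (m ^ 2).

Definition step m (b : bool) p :=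
  if b then p.+1 %% (m ^ 2) else (p + (m ^ 2 - m.-1)) %% (m ^ 2).

Fixpoint run m (f : bool -> nat -> nat) (w : seq bool) p : seq nat :=
  if w is b :: w' then f b p :: run m f w' (step m b p) else [::].

Section Walks.
Variable m : nat.
Hypothesis m_gt1 : 1 < m.
Let n := m ^ 2.
Let D := circulant n [:: 1; m.+1].
Implicit Types (x y : 'I_n) (w : seq bool).

Lemma pos_adv b x : pos m (adv m b x) = step m b (pos m x).
Proof.
rewrite /pos /step; case: b => /=; rewrite -/n modnMml mulnDl ?mul1n; last first.
  exact: esym (modnDml _ _ _).
rewrite -[(_ %% n).+1]addn1 [RHS]modnDml -modnDmr -[RHS]modnDmr; congr ((_ + _) %% _).
(* Both sides are [m ^ 3 + 1], so the multiplier is inverse to [m + 1] modulo [m ^ 2]. *)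
have -> : m.+1 * (n - m.-1) = m * n + 1.
  by rewrite /n -mulnn; case: (m) m_gt1 => //= k _; nia.
by rewrite modnMDl.
Qed.

Lemma circulantP x y : reflect (exists b, y = adv m b x) (D x y).
Proof.
have small := modn_small (ltn_ord y).
apply: (iffP idP) => [|[b ->]].
  rewrite /D /circulant /= orbF small.
  by case/orP => /eqP e; [exists false | exists true]; apply: val_inj; rewrite /= e.
by rewrite /D /circulant /= modn_mod orbF; case: b; rewrite eqxx ?orbT.
Qed.

Lemma size_walk w x : size (walk m w x) = size w.
Proof. by elim: w x => //= b w IH x; rewrite IH. Qed.

Lemma walk_path w x : path D x (walk m w x).
Proof.
elim: w x => //= b w IH x; rewrite IH andbT.
by apply/circulantP; exists b.
Qed.

Lemma path_walk x p : path D x p -> exists w, p = walk m w x.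
Proof.
elim: p x => [|y p IH] x /=; first by exists [::].
by case/andP=> /circulantP[b ->] /IH[w ->]; exists (b :: w).
Qed.

Lemma last_walk w x : val (last x (walk m w x)) = (x + shift m w) %% n.
Proof.
elim: w x => [|b w IH] x.
  by rewrite /shift /= muln0 !addn0 modn_small.
rewrite [LHS]IH /= modnDml; congr (_ %% _).
by rewrite -addnA; congr (_ + _); rewrite /shift /= mulnDr; case: b => /=; lia.
Qed.

(** Allows a colouring of pairs of vertices to tell long arcs from short ones. *)
Lemma adv_inj x : adv m true x != adv m false x.
Proof.
have n2 : m.+1 < n by rewrite /n -mulnn; nia.
rewrite -val_eqE /= eqn_modDl !modn_small //; lia.
Qed.

Lemma shortest_walk x y a b p : a <= m -> (b + 2 <= m) || (a == 0) && (b < m) ->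
  (x + (a + m.+1 * b)) %% n = y -> path D x p -> last x p = y -> a + b <= size p.
Proof.
move=> ha hb exy /path_walk[w ->] lw.
rewrite size_walk -(count_predC negb w).
have -> : count (predC negb) w = count id w by apply: eq_count; case.
apply: (@shortest_word m) => //; apply/eqP; rewrite -(eqn_modDl x).
by rewrite exy -lw last_walk.
Qed.

(** Since [n - 2 = m + (m + 1) * (m - 2)], the vertices [0] and [n - 2] are at distance [2 * m - 2],
    and a rainbow path has no more arcs than there are colours. *)
Lemma rc_lower c (col : 'I_n -> 'I_n -> 'I_c) :
  rainbow_connected D col -> 2 * m - 2 <= c.
Proof.
have n2 : 3 < n by rewrite /n -mulnn; nia.
have l0 : 0 < n by apply: ltn_trans n2.
have l2 : n - 2 < n by rewrite ltn_subrL.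
case/(_ (Ordinal l0) (Ordinal l2)) => [|p /andP[/and3P[pp _ /eqP lp] rb]].
  by rewrite -val_eqE /= eq_sym -lt0n subn_gt0 (ltn_trans _ n2).
have := @shortest_walk (Ordinal l0) (Ordinal l2) m (m - 2) p.
have -> : m + (m - 2) = 2 * m - 2 by lia.
move=> h; apply: leq_trans (h _ _ _ pp lp) _ => //; first lia.
  rewrite /= add0n; have -> : m + m.+1 * (m - 2) = n - 2; last exact: modn_small.
  rewrite -[LHS](addnK 2) /n -mulnn; congr (_ - 2).
  by case: (m) m_gt1 => [|[|k]] // _; rewrite !subSS subn0 !mulSn !mulnS; lia.
have := card_uniqP rb; rewrite size_map /arcs_of size_zip /= => e.
have := max_card (mem [seq col a.1 a.2 | a <- zip (Ordinal l0 :: p) p]).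
by rewrite card_ord e (minn_idPr (leqnSn _)).
Qed.

(** The word [w] may differ from [a] short and [b] long arcs: equal length and equal displacement
    modulo [n] already make it a shortest walk. *)
Lemma rc_src_eq (f : bool -> nat -> nat) :
  (forall b p, p < n -> f b p < 2 * m - 2) ->
  (forall p a b, p < n -> a <= m -> (b + 2 <= m) || (a == 0) && (b < m) ->
     exists w, [/\ uniq (run m f w p), size w = a + b &
                   shift m w = a + m.+1 * b %[mod n]]) ->
  src_star_eq D (2 * m - 2) /\ rc_star_eq D (2 * m - 2).
Proof.
move=> fb fw.
have c0 : 0 < 2 * m - 2 by lia.
have n0 : 0 < n by rewrite /n expn_gt0; lia.
(* The reduction modulo [2 * m - 2] only supplies the bound of the ordinal; by [fb] it changes no
   colour. *)
pose col (i j : 'I_n) : 'I_(2 * m - 2) :=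
  Ordinal (ltn_pmod (f (j != adv m false i) (pos m i)) c0).
have colE w x : [seq val (col a.1 a.2) | a <- arcs_of x (walk m w x)] =
                run m f w (pos m x).
  elim: w x => //= b w IH x; rewrite -pos_adv -IH; congr (_ :: _).
  have -> : (adv m b x != adv m false x) = b by case: b; rewrite ?eqxx ?adv_inj.
  by rewrite modn_small ?fb ?ltn_pmod.
have src : strongly_rainbow_connected D col.
  move=> x y xy.
  have [|a [b [ha hb eab]]] := @distance_word m ((y + (n - x)) %% n).
    rewrite ltn_pmod // andbT lt0n; apply: contra xy => h.
    rewrite -val_eqE /= -(modn_small (ltn_ord x)) -[X in _ == X](modn_small (ltn_ord y)).
    by rewrite eq_sym -(eqn_modDr (n - x)) subnKC ?modnn // ltnW.
  have [w [uw sw ew]] := fw (pos m x) a b (ltn_pmod _ n0) ha hb.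
  have exy : (x + (a + m.+1 * b)) %% n = y.
    rewrite eab modnDmr addnCA subnKC ?(ltnW (ltn_ord x)) //.
    by rewrite modnDr modn_small.
  have lw : last x (walk m w x) = y.
    by apply: val_inj; rewrite last_walk -modnDmr ew modnDmr exy.
  have wmin q : path D x q -> last x q = y -> size (walk m w x) <= size q.
    by rewrite size_walk sw; apply: shortest_walk.
  exists (walk m w x); split.
  - rewrite /dpath walk_path lw eqxx andbT /=.
    by apply: (@shortest_path_uniq _ D) (walk_path _ _) _ => q pq; rewrite lw; apply: wmin.
  - rewrite /rainbow; apply: (@map_uniq _ _ val).
    by rewrite -map_comp; have /= -> := colE w x.
  - by move=> q /and3P[pq _ /eqP lq]; apply: wmin.
have weak c (g : 'I_n -> 'I_n -> 'I_c) :
    strongly_rainbow_connected D g -> rainbow_connected D g.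
  by move=> h x y /h[p [dp rp _]]; exists p; rewrite dp.
split; split; [by exists col | | by exists col; apply: weak | exact: rc_lower].
by move=> c g /weak; apply: rc_lower.
Qed.

End Walks.

(** * The colouring on the array of positions *)

Section Colouring.
Variable m : nat.
Hypothesis m_gt3 : 3 < m.
Implicit Types (w : seq bool) (X E : seq nat).

(** Position [m ^ 2 - 2] ends row [m], and [m ^ 2 - 1] is the lone last one. A short arc leaving row
    [m - 1] in column [c > 0] shares the extra colour of column [c - 1], which stays free if the
    long arcs of a route leave columns [c] and beyond. *)
Definition colour (b : bool) p :=
  let r := p %/ m.-1 in let c := p %% m.-1 in
  if b then
    if p == m ^ 2 - 2 then 0 else
    if (p == m ^ 2 - 1) || (c == m - 2) then p %% m else m + c
  else if (r == m.-1) && (0 < c) then m + c.-1 else p %% m.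

Definition cell r c := r * m.-1 + c.

(* [X] lists integer lifts of the colours that are residues modulo [m], and [E] the
   columns [c] that stand for the extra colours [m + c]. *)
Definition traces p w q X E :=
  foldl (fun p b => step m b p) p w = q /\
  perm_eq (run m colour w p) (map (modn^~ m) X ++ map (addn m) E).

Lemma sqE : m ^ 2 = m.+1 * m.-1 + 1.
Proof. by rewrite -mulnn; case: (m) m_gt3 => // k _ /=; rewrite !mulSn !mulnS; lia. Qed.

Lemma cell_div r c : c <= m - 2 -> cell r c %/ m.-1 = r.
Proof. by move=> h; rewrite /cell divnMDl ?divn_small; lia. Qed.

Lemma cell_modp r c : c <= m - 2 -> cell r c %% m.-1 = c.
Proof. by move=> h; rewrite /cell modnMDl modn_small; lia. Qed.

(** As [m - 1] is [-1] modulo [m], the residue is that of [c - r]; the term [k * m] avoids truncated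
    subtraction. *)
Lemma cell_mod r c y k : y + r = c + k * m -> cell r c %% m = y %% m.
Proof.
move=> h; apply/eqP; rewrite -(eqn_modDr r) h /cell -addnA (addnC c) addnA.
have -> : r * m.-1 + r = r * m by rewrite -mulnSr prednK //; lia.
by rewrite modnMDl addnC modnMDl.
Qed.

Lemma cell_last : cell m.+1 0 = m ^ 2 - 1.
Proof. by rewrite sqE /cell; lia. Qed.

Lemma cell_le r c : r <= m -> c <= m - 2 -> cell r c <= m ^ 2 - 2.
Proof.
move=> hr hc; rewrite sqE /cell; have := leq_mul hr (leqnn m.-1).
by rewrite mulSn; lia.
Qed.

Lemma cell_special r c : r <= m -> c <= m - 2 ->
  (cell r c == m ^ 2 - 2) = (r == m) && (c == m - 2).
Proof.
move=> hr hc; have -> : m ^ 2 - 2 = cell m (m - 2) by rewrite sqE /cell mulSn; lia.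
apply/eqP/andP => [e|[/eqP-> /eqP->] //]; split; apply/eqP.
  by rewrite -(cell_div r hc) e cell_div.
by rewrite -(cell_modp r hc) e cell_modp.
Qed.

Lemma cellS r c : cell r.+1 c = cell r c + m.-1.
Proof. by rewrite /cell mulSn; lia. Qed.

Lemma run_cat f w1 w2 p : run m f (w1 ++ w2) p =
  run m f w1 p ++ run m f w2 (foldl (fun p b => step m b p) p w1).
Proof. by elim: w1 p => //= b w1 IH p; rewrite IH. Qed.

Lemma traces_cat p q s w1 w2 X1 X2 E1 E2 :
  traces p w1 q X1 E1 -> traces q w2 s X2 E2 ->
  traces p (w1 ++ w2) s (X1 ++ X2) (E1 ++ E2).
Proof.
move=> [e1 p1] [e2 p2]; split; first by rewrite foldl_cat e1.
rewrite run_cat e1 !map_cat.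
apply: (perm_trans (perm_cat p1 p2)).
by rewrite -!catA perm_cat2l !catA perm_cat2r perm_catC.
Qed.

(** Lifts in a window of length [m] have distinct residues, and residues lie below all extra
    colours. *)
Lemma traces_uniq y p w q X E : traces p w q X E ->
  uniq X -> (forall x, x \in X -> y <= x < y + m) -> uniq E -> uniq (run m colour w p).
Proof.
move=> [_ /perm_uniq->] uX hX uE; rewrite cat_uniq (map_inj_uniq (@addnI m)) uE andbT.
apply/andP; split.
  rewrite map_inj_in_uniq // => a b /hX ha /hX hb /eqP e.
  wlog le : a b ha hb e / a <= b.
    by move=> H; case/orP: (leq_total a b) => h; [|symmetry]; apply: H; rewrite // eq_sym.
  move: e; rewrite eq_sym eqn_mod_dvd //; case: (posnP (b - a)) => [|lt /dvdn_leq]; first lia.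
  by move/(_ lt); lia.
apply/hasPn => _ /mapP[e _ ->]; apply/negP => /mapP[x _ ex].
by have := ltn_pmod x (ltnW (ltnW (ltnW m_gt3))); lia.
Qed.

Lemma traces1 p b q X E : step m b p = q ->
  [:: colour b p] = map (modn^~ m) X ++ map (addn m) E -> traces p [:: b] q X E.
Proof. by move=> e1 e2; split; rewrite //= e2. Qed.

(** * Colours of single arcs *)

Lemma step_long p : p.+1 < m ^ 2 -> step m true p = p.+1.
Proof. by move=> h; rewrite /step modn_small. Qed.

Lemma step_short p : p + m.-1 < m ^ 2 -> step m false (p + m.-1) = p.
Proof.
move=> h; rewrite /step -addnA subnKC; last lia.
by rewrite modnDr modn_small; lia.
Qed.

Lemma step_cross p : p < m.-1 -> step m false p = p + (m ^ 2 - m.-1).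
Proof. by move=> h; rewrite /step modn_small //; have := sqE; rewrite mulSn; lia. Qed.

Lemma long_extra r c : r <= m -> c < m - 2 ->
  traces (cell r c) [:: true] (cell r c.+1) [::] [:: c].
Proof.
move=> hr hc; have hc' := ltnW hc; apply: traces1.
  by rewrite step_long ?/cell ?addnS //; have := cell_le hr hc; rewrite /cell sqE; lia.
rewrite /= cell_special // cell_modp //; have := cell_le hr hc'.
do 2 (case: ifP; first lia).
by move=> *.
Qed.

Lemma long_star r y k : r < m -> y + r = m - 2 + k * m ->
  traces (cell r (m - 2)) [:: true] (cell r.+1 0) [:: y] [::].
Proof.
move=> hr hy; apply: traces1.
  rewrite step_long /cell; first by rewrite mulSn; lia.
  by have := cell_le (ltnW hr) (leqnn (m - 2)); rewrite /cell sqE; lia.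
rewrite /= cell_special ?(ltnW hr) // cell_modp // eqxx orbT (cell_mod hy).
by case: ifP => //; lia.
Qed.

(** The position has residue [m - 2], already the colour of the long arc that ends row [0]; the
    colour [0] avoids a clash in [route_corner]. *)
Lemma long_special k : traces (cell m (m - 2)) [:: true] (cell m.+1 0) [:: k * m] [::].
Proof.
apply: traces1; last by rewrite /= cell_special ?eqxx //= modnMl.
have -> : cell m.+1 0 = (cell m (m - 2)).+1 by rewrite /cell mulSn; lia.
by rewrite step_long // /cell sqE mulSn; lia.
Qed.

Lemma long_last y k : y + m.+1 = k * m ->
  traces (cell m.+1 0) [:: true] (cell 0 0) [:: y] [::].
Proof.
move=> hy; apply: traces1; rewrite /= cell_last.
  by rewrite subn1 prednK ?modnn // expn_gt0; lia.
rewrite eqxx /= -cell_last (@cell_mod _ _ y k) ?add0n //.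
by rewrite cell_last; case: ifP => //; have := sqE; lia.
Qed.

Lemma short_layer r c y k : c <= m - 2 -> r + (0 < c) <= m -> (c == 0) || (r != m - 2) ->
  y + r.+1 = c + k * m -> traces (cell r.+1 c) [:: false] (cell r c) [:: y] [::].
Proof.
move=> hc hr hrc hy.
apply: traces1; last first.
  by rewrite /= cell_div // cell_modp // (cell_mod hy); case: ifP => //; lia.
rewrite cellS step_short // -cellS.
case: c hc hr {hrc hy} => [|c] hc hr; last by have := @cell_le r.+1 c.+1; rewrite sqE; lia.
have hr' : r.+1 <= m.+1 by lia.
by rewrite /cell sqE; have := leq_mul hr' (leqnn m.-1); lia.
Qed.

Lemma short_extra c : 0 < c <= m - 2 ->
  traces (cell m.-1 c) [:: false] (cell (m - 2) c) [::] [:: c.-1].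
Proof.
move=> /andP[c0 hc]; have e : cell m.-1 c = cell (m - 2) c + m.-1.
  by rewrite -cellS; congr cell; lia.
apply: traces1; last by rewrite /= cell_div // cell_modp // eqxx c0.
by rewrite e step_short // -e; have := @cell_le m.-1 c; rewrite sqE; lia.
Qed.

(* The head of the short arc that leaves the top cell of column [c]. *)
Definition above c := if c < m - 2 then cell m c.+1 else cell m.+1 0.

Lemma short_cross c y k : c <= m - 2 -> y = c + k * m ->
  traces (cell 0 c) [:: false] (above c) [:: y] [::].
Proof.
move=> hc hy; apply: traces1.
  rewrite step_cross; last by rewrite /cell; lia.
  by rewrite /above /cell sqE !mulSn; case: ifP; lia.
rewrite /= cell_div // (@cell_mod _ _ y k) ?addn0 //.
by case: ifP => //; lia.
Qed.

(** * Runs of equal arcs *)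

Lemma longs r c d b : r <= m -> d <= m - 2 -> c + b = d ->
  traces (cell r c) (nseq b true) (cell r d) [::] (iota c b).
Proof.
move=> hr hd; elim: b c => [|b IH] c e; first by rewrite -e addn0.
apply: (@traces_cat _ _ _ [:: true] _ [::] [::] [:: c]).
  by apply: long_extra; lia.
by apply: IH; lia.
Qed.

Lemma shorts r s c y k a : c <= m - 2 -> r + (0 < c) <= m.+1 -> s + a = r ->
  (c == 0) || (r < m.-1) -> y + r = c + k * m ->
  traces (cell r c) (nseq a false) (cell s c) (iota y a) [::].
Proof.
move=> hc; elim: a r y => [|a IH] r y hr e hrc hy; first by rewrite -e addn0.
case: r hr e hrc hy => [|r] hr e hrc hy; first lia.
apply: (@traces_cat _ (cell r c) _ [:: false] _ [:: y] _ [::] [::]).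
  by apply: (short_layer (k := k)); lia.
by apply: IH; lia.
Qed.

(** The arc that leaves row [m - 1] may trade its lift for the extra colour [c - 1]; [h] counts
    this, and [X] then omits that lift. *)
Lemma shorts_column r c y k a : c <= m - 2 -> r + (0 < c) <= m.+1 -> a <= r ->
  y + r = c + k * m -> exists X h,
  [/\ traces (cell r c) (nseq a false) (cell (r - a) c) X (nseq h c.-1),
      subseq X (iota y a) & h <= (0 < c)].
Proof.
move=> hc; elim: a r y => [|a IH] r y hr ha hy.
  by exists [::], 0; rewrite subn0.
case: r hr ha hy => // r hr ha hy; rewrite subSS.
case hrc: ((c == 0) || (r != m - 2)).
  have [||| X [h [tX sX hh]]] := IH r y.+1; [lia | lia | lia |].
  exists (y :: X), h; split => //; last by rewrite /= eqxx.
  apply: (@traces_cat _ (cell r c) _ [:: false] _ [:: y] _ [::]) tX.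
  by apply: (short_layer (k := k)); lia.
have {hrc} [c0 er] : 0 < c /\ r = m - 2 by lia.
exists (iota y.+1 a), 1; split; [| exact: subseq_cons | by rewrite c0].
apply: (@traces_cat _ (cell r c) _ [:: false] _ [::] _ [:: c.-1] [::]).
  have -> : r.+1 = m.-1 by lia.
  by rewrite er; apply: short_extra; rewrite c0.
by apply: (shorts (k := k)); lia.
Qed.

Lemma shorts_cross r c y k a : c <= m - 2 -> r < a <= m -> (c == 0) || (r < m.-1) ->
  y + r = c + k * m -> exists X h,
  [/\ traces (cell r c) (nseq a false)
        (if c < m - 2 then cell (m + r.+1 - a) c.+1 else cell (m.+1 + r.+1 - a) 0)
        X (nseq h c),
      subseq X (iota y a) & h <= (c < m - 2)].
Proof.
move=> hc /andP[ra am] hrc hy.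
(* Climb to row [0], cross the top, then climb in the next column; the lifts grow by one throughout,
   the crossing included. *)
have -> : a = r + (1 + (a - r.+1)) by lia.
set a' := a - r.+1.
have t1 : traces (cell r c) (nseq r false) (cell 0 c) (iota y r) [::].
  by apply: (shorts (k := k)); lia.
have t2 := @short_cross c (y + r) k hc hy.
have [X [h [t3 sX hh]]] : exists X h,
  [/\ traces (above c) (nseq a' false)
        (if c < m - 2 then cell (m + r.+1 - a) c.+1 else cell (m.+1 + r.+1 - a) 0)
        X (nseq h c),
      subseq X (iota (y + r + 1) a') & h <= (c < m - 2)].
  rewrite /above; case: ifP => hc'.
    have [||||X [h [t sX hh]]] := @shorts_column m c.+1 (y + r + 1) k.+1 a'; try lia.
    exists X, h; split => //.
    by have -> : m + r.+1 - a = m - a' by lia.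
  exists (iota (y + r + 1) a'), 0; split => //.
  have -> : m.+1 + r.+1 - a = m.+1 - a' by lia.
  by apply: (shorts (k := k.+2)); lia.
exists (iota y r ++ [:: y + r] ++ X), h; split => //.
- have -> : m + r.+1 - (r + (1 + a')) = m + r.+1 - a by lia.
  have -> : m.+1 + r.+1 - (r + (1 + a')) = m.+1 + r.+1 - a by lia.
  rewrite !nseqD; apply: (@traces_cat _ _ _ _ _ _ _ [::]) t1 _.
  by apply: (@traces_cat _ _ _ _ _ _ _ [::]) t2 t3.
- by rewrite !iotaD /=; apply: cat_subseq => //=; rewrite eqxx.
Qed.

(** * Rainbow routes for every start and every shortest pair [a], [b] *)

#[local] Arguments iota : simpl never.

Definition routes p a b := exists w,
  [/\ uniq (run m colour w p), count negb w = a & count id w = b].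

Lemma traces_route y p w q X E a b : traces p w q X E ->
  uniq X -> (forall x, x \in X -> y <= x < y + m) -> uniq E ->
  count negb w = a -> count id w = b -> routes p a b.
Proof. by move=> t uX hX uE ca cb; exists w; split=> //; apply: traces_uniq t _ hX _. Qed.

Ltac uniq_iota :=
  repeat (rewrite ?cats0 ?(mem_cat, mem_iota, mem_nseq, inE) ?cat_uniq ?iota_uniq /= ?negb_or ?andbT;
    first [lia | apply/andP; split | apply/hasPn => ? | move=> ?]).
Ltac count_word := rewrite ?(count_cat, count_nseq) /= ?(count_cat, count_nseq) /=; lia.

Lemma subseq_iota X y a : subseq X (iota y a) ->
  uniq X /\ forall x, x \in X -> y <= x < y + a.
Proof.
move=> s; split; first exact: subseq_uniq s (iota_uniq _ _).
by move=> x /(mem_subseq s); rewrite mem_iota.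
Qed.

Lemma uniq_nseq (x : nat) h : h <= 1 -> uniq (nseq h x).
Proof. by case: h => [|[]]. Qed.

(** Short arcs come first: the extra colour [c - 1] that they may take is not one of those of the
    long arcs, [c] to [c + b - 1]. *)
Lemma route_below r c a b : r <= m -> a <= r -> a <= m -> c + b <= m - 2 ->
  routes (cell r c) a b.
Proof.
move=> hr ar am cb.
have [||||X [h [t1 sX hh]]] := @shorts_column r c (c + 2 * m - r) 2 a; try lia.
have [uX hX] := subseq_iota sX.
have t2 : traces (cell (r - a) c) (nseq b true) (cell (r - a) (c + b)) [::] (iota c b).
  by apply: longs; lia.
apply: (traces_route (y := c + 2 * m - r)) (traces_cat t1 t2) _ _ _ _ _; rewrite ?cats0 //.
- by move=> x /hX; lia.
- have := uniq_nseq c.-1 (leq_trans hh (leq_b1 _)); uniq_iota.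
- count_word.
- count_word.
Qed.

Ltac route t y := apply: (traces_route (y := y) t);
  [try by uniq_iota | try by move=> x; uniq_iota | try by uniq_iota
  | count_word | count_word].

Lemma route_across r c a b : r <= m - 2 -> r < a <= m -> c + b <= m - 2 ->
  routes (cell r c) a b.
Proof.
move=> hr ra cb.
have t1 : traces (cell r c) (nseq b true) (cell r (c + b)) [::] (iota c b).
  by apply: longs; lia.
have [|||| X [h [t2 sX hh]]] := @shorts_cross r (c + b) (c + 2 * m - r + b) 2 a; try lia.
have [uX hX] := subseq_iota sX.
have uh := uniq_nseq (c + b) (leq_trans hh (leq_b1 _)).
by route (traces_cat t1 t2) (c + 2 * m - r + b) => // x /hX; lia.
Qed.

Lemma route_top1 c b : 0 < c -> c + b <= m - 2 -> routes (cell m.-1 c) m b.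
Proof.
move=> c0 cb.
have t1 : traces (cell m.-1 c) [:: false] (cell (m - 2) c) [::] [:: c.-1].
  by apply: short_extra; lia.
have t2 : traces (cell (m - 2) c) (nseq b true) (cell (m - 2) (c + b)) [::] (iota c b).
  by apply: longs; lia.
have [|||| X [h [t3 sX hh]]] := @shorts_cross (m - 2) (c + b) (c + b + 2) 1 m.-1; try lia.
have [uX hX] := subseq_iota sX.
have uh := uniq_nseq (c + b) (leq_trans hh (leq_b1 _)).
by route (traces_cat t1 (traces_cat t2 t3)) (c + b + 2) => // x /hX; lia.
Qed.

Lemma route_top0 b : b <= m - 2 -> routes (cell m.-1 0) m b.
Proof.
case: b => [_|b hb].
  have [|||| X [h [t sX hh]]] := @shorts_cross m.-1 0 1 1 m; try lia.
  have [uX hX] := subseq_iota sX.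
  have uh := uniq_nseq 0 (leq_trans hh (leq_b1 _)).
  by route t 1 => // x /hX; lia.
have t1 : traces (cell m.-1 0) [:: false] (cell (m - 2) 0) [:: m.+1] [::].
  have -> : m.-1 = (m - 2).+1 by lia.
  by apply: (short_layer (k := 2)); lia.
case: (posnP b) => [-> |b0].
  have [|||| X [h [t2 sX hh]]] := @shorts_cross (m - 2) 0 2 1 m.-1; try lia.
  have [uX hX] := subseq_iota sX.
  have uh := uniq_nseq 0 (leq_trans hh (leq_b1 _)).
  have t3 : traces (cell m 1) [:: true] (cell m 2) [::] [:: 1] by apply: long_extra; lia.
  move: t2; rewrite ifT; last lia.
  have -> : m + (m - 2).+1 - m.-1 = m by lia.
  move=> t2; route (traces_cat t1 (traces_cat t2 t3)) 2 => //.
  - by rewrite cats0 /= uX andbT; apply/negP => /hX; lia.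
  - by move=> x; rewrite cats0 /= inE => /orP[/eqP->|/hX]; lia.
have t2 : traces (cell (m - 2) 0) (nseq b true) (cell (m - 2) b) [::] (iota 0 b).
  by apply: longs; lia.
have t3 : traces (cell (m - 2) b) (nseq (m - b.+1) false) (cell b.-1 b)
    (iota b.+2 (m - b.+1)) [::] by apply: (shorts (k := 1)); lia.
(* This long arc leaves a position of residue [1], the colour of the first short arc, so the climb
   resumes just past the residue already used. *)
have t4 : traces (cell b.-1 b) [:: true] (cell b.-1 b.+1) [::] [:: b].
  by apply: long_extra; lia.
have [|||| X [h [t5 sX hh]]] := @shorts_cross b.-1 b.+1 (m + 2) 1 b; try lia.
have [uX hX] := subseq_iota sX.
have uh := uniq_nseq b.+1 (leq_trans hh (leq_b1 _)).
route (traces_cat t1 (traces_cat t2 (traces_cat t3 (traces_cat t4 t5)))) b.+2.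
- rewrite /= cat_uniq iota_uniq uX andbT mem_cat mem_iota negb_or /=.
  apply/andP; split; last by apply/hasPn => x /hX; rewrite mem_iota; lia.
  by apply/andP; split; [lia | apply/negP => /hX; lia].
- by move=> x; rewrite /= inE mem_cat mem_iota => /or3P[/eqP->| |/hX]; lia.
Qed.

(** The arc out of the last column takes one residue, which leaves room for [a < m] short arcs,
    taken from column [0]. The remaining [k] long arcs stay in columns before [c]. *)
Lemma route_star r c a b : r < m -> a < m -> c <= m - 2 -> m.-1 <= c + b ->
  (b <= m - 2) || (a == 0) && (b < m) -> routes (cell r c) a b.
Proof.
move=> hr ha hc hcb hb; pose k := c + b - m.-1.
have t1 : traces (cell r c) (nseq (m - 2 - c) true) (cell r (m - 2)) [::] (iota c (m - 2 - c)).
  by apply: longs; lia.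
have t2 : traces (cell r (m - 2)) [:: true] (cell r.+1 0) [:: 3 * m - 2 - r] [::].
  by apply: (long_star (k := 2)); lia.
case: (leqP a r.+1) => har.
  have t3 : traces (cell r.+1 0) (nseq a false) (cell (r.+1 - a) 0)
      (iota (3 * m - 1 - r) a) [::] by apply: (shorts (k := 3)); lia.
  have t4 : traces (cell (r.+1 - a) 0) (nseq k true) (cell (r.+1 - a) k) [::] (iota 0 k).
    by apply: longs; lia.
  by route (traces_cat t1 (traces_cat t2 (traces_cat t3 t4))) (3 * m - 2 - r).
have [|||| X [h [t3 sX hh]]] := @shorts_cross r.+1 0 (3 * m - 1 - r) 3 a; try lia.
have [uX hX] := subseq_iota sX.
have uh := uniq_nseq 0 (leq_trans hh (leq_b1 _)).
move: t3; rewrite ifT; last lia.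
move=> t3.
have t4 : traces (cell (m + r.+2 - a) 1) (nseq k true) (cell (m + r.+2 - a) k.+1)
    [::] (iota 1 k) by apply: longs; lia.
route (traces_cat t1 (traces_cat t2 (traces_cat t3 t4))) (3 * m - 2 - r).
- by rewrite cats0 /= uX andbT; apply/negP => /hX; lia.
- by move=> x; rewrite cats0 /= inE => /orP[/eqP->|/hX]; lia.
Qed.

(** If [a > 0], a short arc in the last column moves to row [m - 1], whose end leads to column [0]
    without the exceptional arc of row [m]. *)
Lemma route_bottom c a b : a < m -> c <= m - 2 -> m.-1 <= c + b ->
  (b <= m - 2) || (a == 0) && (b < m) -> routes (cell m c) a b.
Proof.
move=> ha hc hcb hb; pose k := c + b - m.-1.
have t1 : traces (cell m c) (nseq (m - 2 - c) true) (cell m (m - 2)) [::] (iota c (m - 2 - c)).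
  by apply: longs; lia.
case: a ha hb => [ha hb|a ha hb].
  have t2 := long_special 1.
  case ek : k => [|k'].
    by route (traces_cat t1 t2) m.
  have t3 : traces (cell m.+1 0) [:: true] (cell 0 0) [:: m.-1] [::].
    by apply: (long_last (k := 2)); lia.
  have t4 : traces (cell 0 0) (nseq k' true) (cell 0 k') [::] (iota 0 k').
    by apply: longs; lia.
  by route (traces_cat t1 (traces_cat t2 (traces_cat t3 t4))) m.-1.
have t2 : traces (cell m (m - 2)) [:: false] (cell m.-1 (m - 2)) [:: m - 2] [::].
  have {1}-> : m = m.-1.+1 by lia.
  by apply: (short_layer (k := 1)); lia.
have t3 : traces (cell m.-1 (m - 2)) [:: true] (cell m 0) [:: m.-1] [::].
  have {3}-> : m = m.-1.+1 by lia.
  by apply: (long_star (k := 1)); lia.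
have t4 : traces (cell m 0) (nseq a false) (cell (m - a) 0) (iota m a) [::].
  by apply: (shorts (k := 2)); lia.
have t5 : traces (cell (m - a) 0) (nseq k true) (cell (m - a) k) [::] (iota 0 k).
  by apply: longs; lia.
by route (traces_cat t1 (traces_cat t2 (traces_cat t3 (traces_cat t4 t5)))) (m - 2).
Qed.

(** All [m] short arcs are taken in the last column and over the top to column [0], so no long arc
    takes a residue. *)
Lemma route_full_low r c b : r <= m - 2 -> c <= m - 2 -> m.-1 <= c + b -> b <= m - 2 ->
  routes (cell r c) m b.
Proof.
move=> hr hc hcb hb; pose k := c + b - (m - 2).
have t1 : traces (cell r c) (nseq (m - 2 - c) true) (cell r (m - 2)) [::] (iota c (m - 2 - c)).
  by apply: longs; lia.
have [|||| X [h [t2 sX hh]]] := @shorts_cross r (m - 2) (2 * m - 2 - r) 1 m; try lia.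
have [uX hX] := subseq_iota sX.
move: t2 hh; rewrite ltnn => t2; rewrite leqn0 => /eqP eh.
have t3 : traces (cell (m.+1 + r.+1 - m) 0) (nseq k true) (cell (m.+1 + r.+1 - m) k)
    [::] (iota 0 k) by apply: longs; lia.
move: t2; rewrite eh => t2.
route (traces_cat t1 (traces_cat t2 t3)) (2 * m - 2 - r) => x.
by rewrite /= cats0 => /hX; lia.
Qed.

(** The first short arc takes the extra colour [c - 1], which frees a residue for the arc out of the
    last column. *)
Lemma route_full_top c b : c <= m - 2 -> m.-1 <= c + b -> b <= m - 2 ->
  routes (cell m.-1 c) m b.
Proof.
move=> hc hcb hb; pose k := c + b - m.-1.
have t1 : traces (cell m.-1 c) [:: false] (cell (m - 2) c) [::] [:: c.-1].
  by apply: short_extra; lia.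
have t2 : traces (cell (m - 2) c) (nseq (m - 2 - c) true) (cell (m - 2) (m - 2))
    [::] (iota c (m - 2 - c)) by apply: longs; lia.
have t3 : traces (cell (m - 2) (m - 2)) [:: true] (cell m.-1 0) [:: m] [::].
  have -> : m.-1 = (m - 2).+1 by lia.
  by apply: (long_star (k := 1)); lia.
have t4 : traces (cell m.-1 0) (nseq m.-1 false) (cell 0 0) (iota m.+1 m.-1) [::].
  by apply: (shorts (k := 2)); lia.
have t5 : traces (cell 0 0) (nseq k true) (cell 0 k) [::] (iota 0 k).
  by apply: longs; lia.
by route (traces_cat t1 (traces_cat t2 (traces_cat t3 (traces_cat t4 t5)))) m.
Qed.

Lemma route_full_bottom c b : c <= m - 2 -> m.-1 <= c + b -> b <= m - 2 -> 1 < b + (m - 2 - c) ->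
  routes (cell m c) m b.
Proof.
move=> hc hcb hb hbj; pose k := c + b - m.-1.
have t1 : traces (cell m c) [:: false] (cell m.-1 c) [:: m + c] [::].
  have {1}-> : m = m.-1.+1 by lia.
  by apply: (short_layer (k := 2)); lia.
have t2 : traces (cell m.-1 c) [:: false] (cell (m - 2) c) [::] [:: c.-1].
  by apply: short_extra; lia.
(* A long arc with an extra colour must skip residue [c], used by the first short arc: in column [0]
   if [k > 0], otherwise in column [m - 3] before the row ends. *)
case: (posnP k) => k0.
  pose j := m - 2 - c.
  have t3 : traces (cell (m - 2) c) (nseq j.-1 true) (cell (m - 2) (m - 3))
      [::] (iota c j.-1) by apply: longs; lia.
  have t4 : traces (cell (m - 2) (m - 3)) (nseq (c + 1) false) (cell j.-1 (m - 3))
      (iota m.-1 (c + 1)) [::] by apply: (shorts (k := 1)); lia.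
  have t5 : traces (cell j.-1 (m - 3)) [:: true] (cell j.-1 (m - 2)) [::] [:: m - 3].
    by have -> : m - 2 = (m - 3).+1 by [lia]; apply: long_extra; lia.
  have t6 : traces (cell j.-1 (m - 2)) [:: true] (cell j 0) [:: m + c.+1] [::].
    have {2}-> : j = j.-1.+1 by lia.
    by apply: (long_star (k := 1)); lia.
  have t7 : traces (cell j 0) (nseq j.-1 false) (cell 1 0) (iota (m + c.+2) j.-1) [::].
    by apply: (shorts (k := 2)); lia.
  by route (traces_cat t1 (traces_cat t2 (traces_cat t3 (traces_cat t4
    (traces_cat t5 (traces_cat t6 t7)))))) m.-1.
have t3 : traces (cell (m - 2) c) (nseq (m - 2 - c) true) (cell (m - 2) (m - 2))
    [::] (iota c (m - 2 - c)) by apply: longs; lia.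
have t4 : traces (cell (m - 2) (m - 2)) [:: true] (cell m.-1 0) [:: m] [::].
  have -> : m.-1 = (m - 2).+1 by lia.
  by apply: (long_star (k := 1)); lia.
have t5 : traces (cell m.-1 0) (nseq c.-1 false) (cell (m - c) 0) (iota m.+1 c.-1) [::].
  by apply: (shorts (k := 2)); lia.
have t6 : traces (cell (m - c) 0) [:: true] (cell (m - c) 1) [::] [:: 0].
  by apply: long_extra; lia.
have t7 : traces (cell (m - c) 1) (nseq (m.-1 - c) false) (cell 1 1)
    (iota (m + c.+1) (m.-1 - c)) [::] by apply: (shorts (k := 2)); lia.
have t8 : traces (cell 1 1) (nseq k.-1 true) (cell 1 k) [::] (iota 1 k.-1).
  by apply: longs; lia.
by route (traces_cat t1 (traces_cat t2 (traces_cat t3 (traces_cat t4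
  (traces_cat t5 (traces_cat t6 (traces_cat t7 t8))))))) m.
Qed.

(* Here [m.+1] long arcs replace [m] short ones and a long one: both make [2 * m + 1]. *)
Lemma route_corner : routes (cell m (m - 2)) 0 m.+1.
Proof.
have t1 := long_special 1.
have t2 : traces (cell m.+1 0) [:: true] (cell 0 0) [:: m.-1] [::].
  by apply: (long_last (k := 2)); lia.
have t3 : traces (cell 0 0) (nseq (m - 2) true) (cell 0 (m - 2)) [::] (iota 0 (m - 2)).
  by apply: longs; lia.
have t4 : traces (cell 0 (m - 2)) [:: true] (cell 1 0) [:: 2 * m - 2] [::].
  by apply: (long_star (k := 1)); lia.
by route (traces_cat t1 (traces_cat t2 (traces_cat t3 t4))) m.-1.
Qed.

Lemma route_last a b : a <= m -> (b <= m - 2) || (a == 0) && (b < m) ->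
  routes (cell m.+1 0) a b.
Proof.
move=> ha hb; case: (posnP a) => a0.
  case: b hb => [_|b hb]; first by exists [::]; rewrite a0.
  have t1 : traces (cell m.+1 0) [:: true] (cell 0 0) [:: m.-1] [::].
    by apply: (long_last (k := 2)); lia.
  have t2 : traces (cell 0 0) (nseq b true) (cell 0 b) [::] (iota 0 b).
    by apply: longs; lia.
  by route (traces_cat t1 t2) m.-1.
have t1 : traces (cell m.+1 0) (nseq a false) (cell (m.+1 - a) 0) (iota m.-1 a) [::].
  by apply: (shorts (k := 2)); lia.
have t2 : traces (cell (m.+1 - a) 0) (nseq b true) (cell (m.+1 - a) b) [::] (iota 0 b).
  by apply: longs; lia.
by route (traces_cat t1 t2) m.-1.
Qed.

(** The second alternative serves the corner alone: [m] long arcs advance by [m ^ 2 + m], hence as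
    far as [m] short ones modulo [m ^ 2]. *)
Lemma route_exists p a b : p < m ^ 2 -> a <= m -> (b + 2 <= m) || (a == 0) && (b < m) ->
  routes p a b \/ a = m /\ routes p 0 (m + b).
Proof.
move=> hp ha hb; have hb' : (b <= m - 2) || (a == 0) && (b < m) by lia.
case: (eqVneq p (cell m.+1 0)) => [->|hpl]; first by left; apply: route_last.
have m1 : 0 < m.-1 by lia.
have hc : p %% m.-1 <= m - 2 by have := ltn_pmod p m1; lia.
have hr : p %/ m.-1 <= m.
  by rewrite -ltnS ltn_divLR // ltn_neqAle; move: hpl hp; rewrite cell_last sqE; lia.
rewrite (divn_eq p m.-1) -/(cell _ _); move: (p %/ _) (p %% _) hr hc => r c hr hc {p hp hpl}.
(* Either [b] long arcs fit in the row, or the last column has to be passed or skipped. *)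
case: (leqP (c + b) (m - 2)) => hcb.
  left; case: (leqP a r) => ar; first exact: route_below.
  case: (leqP r (m - 2)) => hr'; first by apply: route_across => //; rewrite ar.
  have [-> ->] : r = m.-1 /\ a = m by lia.
  case: (posnP c) hcb => [-> | c0] hcb; first exact: route_top0.
  exact: route_top1.
have {}hcb : m.-1 <= c + b by lia.
case: (ltnP a m) => am.
  left; case: (ltnP r m) => hr'; first exact: route_star.
  have -> : r = m by lia.
  exact: route_bottom.
have {}am : a = m by lia.
have {}hb : b <= m - 2 by lia.
rewrite am; case: (leqP r (m - 2)) => hr'; first by left; apply: route_full_low.
case: (ltnP r m) => rm.
  by left; have -> : r = m.-1 by [lia]; apply: route_full_top.
have {rm hr hr'} -> : r = m by lia.
case: (leqP (b + (m - 2 - c)) 1) => hbj; last by left; apply: route_full_bottom.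
have [-> ->] : b = 1 /\ c = m - 2 by lia.
by right; rewrite addn1; split => //; apply: route_corner.
Qed.

Lemma colour_lt b p : colour b p < 2 * m - 2.
Proof.
have hm : p %% m < 2 * m - 2 by have := @ltn_pmod p m; lia.
have hc : p %% m.-1 < m.-1 by apply: ltn_pmod; lia.
rewrite /colour; case: b; last by case: ifP => // /andP[]; lia.
by case: ifP => [|_]; [lia | case: ifP => // /norP[_]; lia].
Qed.

End Colouring.

(** * Conclusion for [m > 3], and the cases [m = 2] and [m = 3] by computation *)

Lemma rc_src_large m : 3 < m ->
  src_star_eq (circulant (m ^ 2) [:: 1; m.+1]) (2 * m - 2) /\
  rc_star_eq (circulant (m ^ 2) [:: 1; m.+1]) (2 * m - 2).
Proof.
move=> m3; apply: (@rc_src_eq m _ (colour m)); [lia | by move=> b p _; apply: colour_lt |].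
move=> p a b hp ha hb.
have size_count (w : seq bool) : size w = count negb w + count id w.
  by rewrite -(count_predC negb); congr (_ + _); apply: eq_count; case.
case: (route_exists m3 hp ha hb) => [[w [uw ca cb]]|[em [w [uw ca cb]]]]; exists w.
  by rewrite size_count /shift ca cb.
split=> //; first by rewrite size_count ca cb em.
have -> : shift m w = 1 * m ^ 2 + (a + m.+1 * b).
  by rewrite /shift ca cb em mulnDr mul1n -mulnn mulSn; lia.
by rewrite modnMDl.
Qed.

Definition words l : seq (seq bool) :=
  iter l (fun s => map (cons true) s ++ map (cons false) s) [:: [::]].

(** The hypotheses of [rc_src_eq] in boolean form, for evaluation. *)
Definition routable m (f : bool -> nat -> nat) :=
  all (fun p => all (fun b => f b p < 2 * m - 2) [:: true; false] &&
    all (fun a => all (fun b => (b + 2 <= m) || (a == 0) && (b < m) ==>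
      has (fun w => [&& uniq (run m f w p), size w == a + b &
                     shift m w == a + m.+1 * b %[mod m ^ 2]])
        (words (a + b)))
      (iota 0 m)) (iota 0 m.+1)) (iota 0 (m ^ 2)).

Lemma rc_src_routable m f : 1 < m -> routable m f ->
  src_star_eq (circulant (m ^ 2) [:: 1; m.+1]) (2 * m - 2) /\
  rc_star_eq (circulant (m ^ 2) [:: 1; m.+1]) (2 * m - 2).
Proof.
move=> m1 rt; have rtp p : p < m ^ 2 -> p \in iota 0 (m ^ 2) by rewrite mem_iota.
apply: (@rc_src_eq m m1 f) => [b p /rtp/(allP rt)/andP[fb _]|p a b /rtp/(allP rt)/andP[_ ra] ha hb].
  by apply: (allP fb); case: b.
have ia : a \in iota 0 m.+1 by rewrite mem_iota ltnS.
have ib : b \in iota 0 m by rewrite mem_iota /=; case/orP: hb; lia.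
have /implyP/(_ hb)/hasP[w _ /and3P[uw /eqP sw /eqP ew]] := allP (allP ra a ia) b ib.
by exists w.
Qed.

Theorem theorem10 (k : nat) (hk : 3 <= k) :
  src_star_eq (circulant ((k - 1) ^ 2) [:: 1; k]) (2 * k - 4) /\
  rc_star_eq (circulant ((k - 1) ^ 2) [:: 1; k]) (2 * k - 4).
Proof.
case: k hk => // m hm; rewrite subn1 /=.
have -> : 2 * m.+1 - 4 = 2 * m - 2 by lia.
case: (ltnP 3 m) => hm3; first exact: rc_src_large.
have [->|->] : m = 2 \/ m = 3 by lia.
  (* The digraph is a 4-cycle with arcs both ways, coloured by the parity of the tail. *)
  by apply: (@rc_src_routable 2 (fun _ p => p %% 2)); last vm_compute.
(* Found by computer search. *)
pose longs := [:: 0; 3; 2; 3; 1; 3; 2; 3; 1].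
by apply: (@rc_src_routable 3 (fun b p => if b then nth 0 longs p else p %% 3)); last vm_compute.
Qed.
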